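(* Let $0\le\ell\le n-1$. Every irreducible subvariety of $\mathrm{Gr}(\ell,\mathbb{P}^n)$ of codimension at most $n-1$ is isotropic.
   Context: $\mathbb{K}$ is an algebraically closed field of characteristic zero, $\mathbb{P}^n=\mathbb{P}(\mathbb{K}^{n+1})$. $\mathrm{Gr}(\ell,\mathbb{P}^n)$ is the Grassmannian of $\ell$-dimensional projective subspaces $L$, with affine cones $\hat L\subset\mathbb{K}^{n+1}$; one identifies $T_{\mathrm{Gr}(\ell,\mathbb{P}^n),L}=\mathrm{Hom}(\hat L,\mathbb{K}^{n+1}/\hat L)$. For vector spaces $U,W$, $\mathrm{Seg}(U,W)\subset\mathbb{P}(\mathrm{Hom}(U,W))$ is the projectivization of $\{\varphi\in\mathrm{Hom}(U,W)\mid\mathrm{rank}\,\varphi\le1\}$. For an irreducible projective variety $Y\subset\mathbb{P}^N$ and $k\ge0$, $\mathrm{Sec}_k(Y)\subset\mathrm{Gr}(k,\mathbb{P}^N)$ is the Zariski closure of $\{M\in\mathrm{Gr}(k,\mathbb{P}^N)\mid M=\mathrm{span}(M\cap Y)\}$. An irreducible subvariety $\Sigma\subset\mathrm{Gr}(\ell,\mathbb{P}^n)$ of dimension $d\ge1$ is isotropic if $\mathbb{P}(T_{\Sigma,L})\in\mathrm{Sec}_{d-1}(\mathrm{Seg}(\hat L,\mathbb{K}^{n+1}/\hat L))$ for every smooth point $L\in\mathrm{Reg}(\Sigma)$. *)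

(* Defs.v *)
(* Plain MathComp, with multinomials for the polynomials in the Pluecker
   coordinates; ClassicalEpsilon provides the choice operator [epsilon]. *)
From Stdlib Require Import ClassicalEpsilon.
From mathcomp Require Import all_boot all_order all_algebra.
From mathcomp Require Import mpoly.

Set Implicit Arguments.
Unset Strict Implicit.
Unset Printing Implicit Defensive.

Import GRing.Theory.

Local Open Scope ring_scope.

(* Conventions.  P(V) is the space of lines of a finite-dimensional vector space
   V.  A projective subspace of P(V) is represented by its affine cone, a
   [{vspace V}], and a subset of a Grassmannian by a predicate on [{vspace V}].
   Grassmannians are indexed by the projective dimension k, so the members of
   Gr(k, P(V)) have vector-space dimension k + 1. *)

(* One Pluecker coordinate for each increasing sequence of m column indices. *)
Notation plucker_index m N :=
  {t : m.-tuple 'I_N | sorted ltn (map val t)}.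

Definition plucker (R : comNzRingType) (m N : nat) (A : 'M[R]_(m, N))
    (i : 'I_#|{: plucker_index m N}|) : R :=
  \det (colsub (tnth (val (enum_val i))) A).

(* The homogeneous coordinate ring of the ambient Pluecker space. *)
Notation plucker_poly K m N := {mpoly K[#|{: plucker_index m N}|]}.

Section Grassmannian.
Variables (K : fieldType) (V : vectType K) (k : nat).

Implicit Types (U L : {vspace V}) (Z C : {vspace V} -> Prop).

Definition Gr U : Prop := \dim U = k.+1.

Definition coord_mx (X : k.+1.-tuple V) : 'M[K]_(k.+1, \dim {:V}) :=
  \matrix_(i, j) coord (vbasis {:V}) j (tnth X i).

(* For homogeneous f this depends on U only: changing the basis X rescales the
   Pluecker vector. *)
Definition vanishes_at (f : plucker_poly K k.+1 (\dim {:V})) U : Prop :=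
  forall X : k.+1.-tuple V, basis_of U X -> f.@[plucker (coord_mx X)] = 0.

Definition homogeneous (f : plucker_poly K k.+1 (\dim {:V})) : Prop :=
  exists e : nat, f \is e.-homog.

Definition zclosed Z : Prop :=
  exists S : plucker_poly K k.+1 (\dim {:V}) -> Prop,
    (forall f, S f -> homogeneous f) /\
    (forall U, Z U <-> Gr U /\ (forall f, S f -> vanishes_at f U)).

Definition subset_of Z C : Prop := forall U, Z U -> C U.

Definition zclosure Z U : Prop :=
  Gr U /\ forall C, zclosed C -> subset_of Z C -> C U.

Definition irreducible_subvariety Z : Prop :=
  [/\ zclosed Z,
      exists U, Z U &
      forall C1 C2, zclosed C1 -> zclosed C2 ->
        (forall U, Z U -> C1 U \/ C2 U) -> subset_of Z C1 \/ subset_of Z C2].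

Definition has_chain Z (d : nat) : Prop :=
  exists C : nat -> {vspace V} -> Prop,
    [/\ forall i, (i <= d)%N -> irreducible_subvariety (C i),
        forall i, (i < d)%N ->
          subset_of (C i) (C i.+1) /\ ~ subset_of (C i.+1) (C i) &
        subset_of (C d) Z].

(* Krull dimension. *)
Definition has_dim Z (d : nat) : Prop :=
  has_chain Z d /\ forall e, has_chain Z e -> (e <= d)%N.

Definition has_codim Z (c : nat) : Prop :=
  exists d e, [/\ has_dim Z d, has_dim Gr e & e = (d + c)%N].

(* M = span (M \cap Y), for Y the affine cone over a subset of P(V). *)
Definition spanned_by_section (Y : V -> Prop) U : Prop :=
  exists s : seq V, (forall y, y \in s -> y \in U /\ Y y) /\ <<s>>%VS = U.

Definition Sec (Y : V -> Prop) : {vspace V} -> Prop :=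
  zclosure (fun U => Gr U /\ spanned_by_section Y U).

End Grassmannian.

(* MathComp has no quotient of vector spaces: V / L is carried by the chosen
   complement of L, and is used only through the projection [quotv_proj], which
   is surjective with kernel L. *)
Notation quotv L := (subvs_of (L^C)%VS).

Section Quotient.
Variables (K : fieldType) (V : vectType K) (L : {vspace V}).

Definition quotv_proj : 'Hom(V, quotv L) :=
  (linfun (vsproj (L^C)%VS) \o daddv_pi (L^C)%VS L)%VF.

Lemma capv_complC : (L^C :&: L = 0)%VS.
Proof. by rewrite capvC capv_compl. Qed.

Lemma quotv_proj_compl (w : quotv L) : quotv_proj (vsval w) = w.
Proof.
rewrite /quotv_proj comp_lfunE /= daddv_pi_id ?capv_complC ?subvsP //.
by rewrite lfunE /= vsvalK.
Qed.

Lemma limg_quotv_proj : limg quotv_proj = fullv.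
Proof.
apply/vspaceP => w; rewrite memvf.
by apply/memv_imgP; exists (vsval w); rewrite ?memvf ?quotv_proj_compl.
Qed.

Lemma lker_quotv_proj : lker quotv_proj = L.
Proof.
apply/vspaceP => v; rewrite memv_ker /quotv_proj comp_lfunE lfunE /=.
have vLC : v \in (L^C + L)%VS by rewrite addvC addv_complf memvf.
have Dv := daddv_pi_add capv_complC vLC.
apply/eqP/idP => [v0|Lv].
  have := vsprojK (memv_pi L^C L v); rewrite v0 linear0 => p0.
  by rewrite -Dv -p0 add0r memv_pi.
move: Dv; rewrite (daddv_pi_id (capv_compl L) Lv) => /(canRL (addrK _)) ->.
by rewrite subrr linear0.
Qed.

End Quotient.

(* The affine cone over Seg(U, W) in Hom(U, W). *)
Definition Seg (K : fieldType) (U W : vectType K) (phi : 'Hom(U, W)) : Prop :=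
  (\dim (limg phi) <= 1)%N.

Section Tangent.
Variables (K : fieldType) (V : vectType K) (k : nat).
Variable Sigma : {vspace V} -> Prop.

Definition in_ideal (f : plucker_poly K k.+1 (\dim {:V})) : Prop :=
  homogeneous f /\ forall U, Sigma U -> vanishes_at f U.

(* The value of f on the Pluecker vector of a_0 + t b_0, ..., a_k + t b_k, as a
   polynomial in the parameter t = 'X. *)
Definition along_line (f : plucker_poly K k.+1 (\dim {:V}))
    (a b : k.+1.-tuple V) : {poly K} :=
  mmap polyC
    (plucker (map_mx polyC (coord_mx a) + 'X *: map_mx polyC (coord_mx b))) f.

(* Under T_L Gr = Hom(L, V / L), phi is the velocity at t = 0 of the curve
   t |-> span(a_0 + t b_0, ..., a_k + t b_k), where a is a basis of L and b_i
   lifts phi(a_i); it is tangent to Sigma when its derivative annihilates the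
   ideal of Sigma.  [vsproj L] only casts the a_i into the type of vectors
   of L. *)
Definition tangent_vector (L : {vspace V}) (phi : 'Hom(subvs_of L, quotv L)) :
    Prop :=
  forall a b : k.+1.-tuple V, basis_of L a ->
    (forall i, quotv_proj L (tnth b i) = phi (vsproj L (tnth a i))) ->
  forall f, in_ideal f -> (along_line f a b)^`().[0] = 0.

(* The subspace of all tangent vectors, by [tangent_spaceP] below. *)
Definition tangent_space (L : {vspace V}) :
    {vspace 'Hom(subvs_of L, quotv L)} :=
  epsilon (inhabits 0%VS)
    (fun T => forall phi, phi \in T <-> tangent_vector phi).

Definition smooth_point (L : {vspace V}) : Prop :=
  Sigma L /\ has_dim k Sigma (\dim (tangent_space L)).

End Tangent.


Section TangentSpec.
Variables (K : fieldType) (V : vectType K) (k : nat).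
Variable Sigma : {vspace V} -> Prop.

(* p, q and r have the same value at 0, and their derivatives there satisfy
   r' = c p' + q'; this relation is stable under sums and products. *)
Let jet_lin (c : K) (p q r : {poly K}) : Prop :=
  [/\ p.[0] = r.[0], q.[0] = r.[0] & r^`().[0] = c * p^`().[0] + q^`().[0]].

Let jet_linC c x : jet_lin c x%:P x%:P x%:P.
Proof. by split=> //; rewrite derivC hornerC mulr0 addr0. Qed.

Let jet_linD c p1 q1 r1 p2 q2 r2 : jet_lin c p1 q1 r1 -> jet_lin c p2 q2 r2 ->
  jet_lin c (p1 + p2) (q1 + q2) (r1 + r2).
Proof.
case=> e1 e2 e3 [e4 e5 e6]; split; rewrite ?hornerD ?e1 ?e2 ?e4 ?e5 //.
by rewrite !derivD !hornerD e3 e6 mulrDr addrACA.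
Qed.

Let jet_linM c p1 q1 r1 p2 q2 r2 : jet_lin c p1 q1 r1 -> jet_lin c p2 q2 r2 ->
  jet_lin c (p1 * p2) (q1 * q2) (r1 * r2).
Proof.
case=> e1 e2 e3 [e4 e5 e6]; split; rewrite ?hornerM ?e1 ?e2 ?e4 ?e5 //.
rewrite !derivM !hornerD !hornerM e1 e2 e3 e4 e5 e6.
by rewrite !mulrDl !mulrDr !mulrA (mulrC r1.[0] c) addrACA.
Qed.

Let jet_lin_sum c (I : Type) (s : seq I) (P : pred I) F G H :
  (forall i, P i -> jet_lin c (F i) (G i) (H i)) ->
  jet_lin c (\sum_(i <- s | P i) F i) (\sum_(i <- s | P i) G i)
    (\sum_(i <- s | P i) H i).
Proof.
move=> h; elim: s => [|i s IH]; first by rewrite !big_nil; apply: jet_linC.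
by rewrite !big_cons; case: ifP => // Pi; apply: jet_linD => //; apply: h.
Qed.

Let jet_lin_prod c (I : Type) (s : seq I) (P : pred I) F G H :
  (forall i, P i -> jet_lin c (F i) (G i) (H i)) ->
  jet_lin c (\prod_(i <- s | P i) F i) (\prod_(i <- s | P i) G i)
    (\prod_(i <- s | P i) H i).
Proof.
move=> h; elim: s => [|i s IH]; first by rewrite !big_nil; apply: jet_linC.
by rewrite !big_cons; case: ifP => // Pi; apply: jet_linM => //; apply: h.
Qed.

Let jet_linX c p q r n : jet_lin c p q r ->
  jet_lin c (p ^+ n) (q ^+ n) (r ^+ n).
Proof.
move=> h; elim: n => [|n IH]; first by rewrite !expr0; apply: jet_linC.
by rewrite !exprS; apply: jet_linM.
Qed.

Lemma along_line_lin (f : plucker_poly K k.+1 (\dim {:V}))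
    (a b b1 b2 : k.+1.-tuple V) (c : K) :
  (forall i, tnth b i = c *: tnth b1 i + tnth b2 i) ->
  (along_line f a b)^`().[0] =
    c * (along_line f a b1)^`().[0] + (along_line f a b2)^`().[0].
Proof.
move=> bE.
suff [_ _ -> //] : jet_lin c (along_line f a b1) (along_line f a b2) (along_line f a b).
rewrite /along_line /mmap.
apply: jet_lin_sum => m _; apply: jet_linM; first exact: jet_linC.
apply: jet_lin_prod => i _; apply: jet_linX.
rewrite /plucker /determinant; apply: jet_lin_sum => s _; apply: jet_linM.
  have E (e : bool) : (-1 : {poly K}) ^+ e = ((-1) ^+ e)%:P.
    by rewrite rmorphXn rmorphN1.
  rewrite E.
  exact: jet_linC.
apply: jet_lin_prod => j _; rewrite !mxE.
apply: jet_linD; first exact: jet_linC.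
rewrite bE linearD linearZ /= !(mulrC 'X) /jet_lin.
by split; rewrite ?hornerMX ?mulr0 // !derivM !derivX !derivC !mul0r !add0r !mulr1 !hornerC.
Qed.

Lemma mmap_homog (f : plucker_poly K k.+1 (\dim {:V})) e u
    (v : 'I_#|{: plucker_index k.+1 (\dim {:V})}| -> K) :
  f \is e.-homog ->
  mmap polyC (fun i => u * (v i)%:P) f = u ^+ e * (f.@[v])%:P.
Proof.
move=> /dhomogP fe; rewrite /meval /mmap raddf_sum mulr_sumr /=.
rewrite !big_seq; apply: eq_bigr => m /fe <-.
rewrite polyCM mulrCA; congr (_ * _).
have -> : u ^+ mdeg m = \prod_i u ^+ m i by rewrite mdegE prodrXr.
rewrite /mmap1 rmorph_prod -big_split /=.
by apply: eq_bigr => i _; rewrite exprMn rmorphXn.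
Qed.

Lemma tangent_vector0 L : Sigma L -> Gr k L ->
  tangent_vector k Sigma (0 : 'Hom(subvs_of L, quotv L)).
Proof.
move=> SL GL a b aL b0 f [[e fe] fS].
have bL i : tnth b i \in L.
  have : tnth b i \in lker (quotv_proj L) by rewrite memv_ker b0 lfunE.
  by rewrite lker_quotv_proj.
pose C := \matrix_(i, j) coord a j (tnth b i).
have CE : coord_mx b = C *m coord_mx a.
  apply/matrixP => i j; rewrite !mxE.
  rewrite {1}(coord_basis aL (bL i)) linear_sum; apply: eq_bigr => l _.
  by rewrite linearZ /= !mxE -tnth_nth.
pose D : 'M[{poly K}]_k.+1 := 1%:M + 'X *: map_mx polyC C.
have DE : map_mx polyC (coord_mx a) + 'X *: map_mx polyC (coord_mx b)
        = D *m map_mx polyC (coord_mx a).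
  by rewrite CE map_mxM /= mulmxDl mul1mx scalemxAl.
suff -> : along_line f a b = 0 by rewrite derivC hornerC.
rewrite /along_line DE.
transitivity (mmap polyC (fun i => \det D * (plucker (coord_mx a) i)%:P) f).
  rewrite /mmap; apply: eq_bigr => m _; congr (_ * _).
  apply: eq_bigr => i _; congr (_ ^+ _); rewrite /plucker -det_map_mx -det_mulmx.
  congr (\det _); apply/matrixP => x y; rewrite !mxE.
  by apply: eq_bigr => z _; rewrite !mxE.
by rewrite (mmap_homog _ _ fe) (fS L SL a aL) mulr0.
Qed.

Lemma tangent_vector_lin L c (p q : 'Hom(subvs_of L, quotv L)) :
  tangent_vector k Sigma p -> tangent_vector k Sigma q ->
  tangent_vector k Sigma (c *: p + q).
Proof.
move=> Tp Tq a b aL bE f fI.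
pose b1 := [tuple vsval (p (vsproj L (tnth a i))) | i < k.+1].
pose b2 := [tuple tnth b i - c *: tnth b1 i | i < k.+1].
have b1E i : quotv_proj L (tnth b1 i) = p (vsproj L (tnth a i)).
  by rewrite tnth_mktuple quotv_proj_compl.
have b2E i : quotv_proj L (tnth b2 i) = q (vsproj L (tnth a i)).
  rewrite tnth_mktuple linearB linearZ /= b1E bE.
  by rewrite !(add_lfunE, scale_lfunE) addrAC subrr add0r.
rewrite (@along_line_lin f a b b1 b2 c) => [|i].
  by rewrite (Tp a b1) // (Tq a b2) // mulr0 addr0.
by rewrite [tnth b2 i]tnth_mktuple addrC subrK.
Qed.

Lemma linear_pred_vspace (W : vectType K) (P : W -> Prop) :
  P 0 -> (forall c u v, P u -> P v -> P (c *: u + v)) ->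
  exists T : {vspace W}, forall u, u \in T <-> P u.
Proof.
move=> P0 Plin.
pose A d := exists2 U : {vspace W}, \dim U = d & forall u, u \in U -> P u.
pose Ab d : bool := if excluded_middle_informative (A d) then true else false.
have AP d : reflect (A d) (Ab d).
  by rewrite /Ab; case: excluded_middle_informative => h; constructor.
have exA : exists d, Ab d.
  exists 0%N; apply/AP; exists 0%VS; first exact: dimv0.
  by move=> u; rewrite memv0 => /eqP ->.
have bdA d : Ab d -> (d <= \dim {:W})%N.
  by move=> /AP[U <- _]; rewrite dimvS ?subvf.
case: (ex_maxnP exA bdA) => d /AP[U Ud UP] maxd.
exists U => u; split; first exact: UP.
move=> Pu; have /AP/maxd : A (\dim (U + <[u]>)%VS).
  exists (U + <[u]>)%VS => // w /memv_addP[x xU [y /vlineP[c ->] ->]].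
  by rewrite addrC; apply: Plin => //; apply: UP.
rewrite -Ud => le; have sub : (U <= U + <[u]>)%VS := addvSl _ _.
have /eqP -> : U == (U + <[u]>)%VS by rewrite eqEdim sub.
by rewrite memvE addvSr.
Qed.

Lemma tangent_spaceP L : Sigma L -> Gr k L ->
  forall phi,
    phi \in tangent_space k Sigma L <-> tangent_vector k Sigma phi.
Proof.
move=> SL GL; apply: (epsilon_spec (inhabits 0%VS)
  (fun T => forall phi, phi \in T <-> tangent_vector k Sigma phi)).
apply: linear_pred_vspace; first exact: tangent_vector0.
by move=> c u v; apply: tangent_vector_lin.
Qed.

End TangentSpec.
Definition isotropic (K : fieldType) (V : vectType K) (k : nat)
    (Sigma : {vspace V} -> Prop) : Prop :=
  irreducible_subvariety k Sigma /\
  exists d : nat,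
    [/\ has_dim k Sigma d,
        (1 <= d)%N &
        forall L, smooth_point k Sigma L ->
          Sec d.-1 (@Seg K (subvs_of L) (quotv L)) (tangent_space k Sigma L)].

(* Main.v *)
Require Import Defs.
From Stdlib Require Import Classical.
From mathcomp Require Import all_boot all_order all_fingroup all_algebra.
From mathcomp Require Import mpoly zify.

Set Implicit Arguments.
Unset Strict Implicit.
Unset Printing Implicit Defensive.

Import GRing.Theory passmx.

Local Open Scope ring_scope.

(* Put a = dim L^ = l + 1 and b = dim K^(n+1)/L^ = n - l.  A chain of cells of
   row spaces [1 | B], with the entries of B freed one at a time, shows
   dim Gr(l, P^n) >= ab, so a tangent space T of Sigma has dimension
   d > (a - 1)(b - 1).  For such d the d-dimensional subspaces of Hom(K^a, K^b)
   spanned by maps of rank <= 1 are dense in the Grassmannian: if a form in the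
   Pluecker coordinates vanishes on all d-tuples of rank-one matrices, the
   entries of the tuple can be freed one at a time.  Indeed, if the other d - 1
   entries contain all matrix units off the first row and column, a matrix with
   nonzero corner is congruent to one of rank one modulo their span.  Arbitrary
   other entries are joined to these by a polynomial path A(t), and the lowest
   nonzero coefficient in t of the form along the path would still vanish on
   rank-one matrices and be invariant under translation by the span of A(0). *)

(** * Polynomial identities over an algebraically closed field *)

Lemma rmorph_mmap (K : nzRingType) (R S : comNzRingType) (phi : {rmorphism K -> R})
    (psi : {rmorphism R -> S}) (m : nat) (v : 'I_m -> R) (f : {mpoly K[m]}) :
  psi (mmap phi v f) = mmap (psi \o phi) (psi \o v) f.
Proof.
rewrite /mmap rmorph_sum; apply: eq_bigr => x _; rewrite rmorphM rmorph_prod.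
by congr (_ * _); apply: eq_bigr => i _; rewrite rmorphXn.
Qed.

Lemma eq_mmap (K R : nzRingType) (phi psi : K -> R) (m : nat) (v w : 'I_m -> R)
    (f : {mpoly K[m]}) :
  phi =1 psi -> v =1 w -> mmap phi v f = mmap psi w f.
Proof.
move=> e1 e2; apply: eq_bigr => x _; rewrite e1; congr (_ * _).
exact: mmap1_eq.
Qed.

Section ClosedField.
Variable K : closedFieldType.

Lemma closed_field_uniq (m : nat) : exists2 s : seq K, uniq s & size s = m.
Proof.
elim: m => [|m [s us ss]]; first by exists [::].
have nz : \prod_(a <- s) ('X - a%:P) != 0 by rewrite monic_neq0 ?monic_prod_XsubC.
have [x] := closed_nonrootP _ nz; rewrite root_prod_XsubC => xs.
by exists (x :: s); rewrite /= ?xs ?ss.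
Qed.

(** An algebraically closed field is infinite and [phi] is injective, so a nonzero [p] would have
    more roots than its degree allows. *)
Lemma poly_eq0_closed (R : idomainType) (phi : {rmorphism K -> R}) (p : {poly R}) :
  (forall x : K, p.[phi x] = 0) -> p = 0.
Proof.
move=> p0; have [s us ss] := closed_field_uniq (size p).
apply/eqP/negPn/negP => nz.
have : (size (map phi s) < size p)%N.
  apply: max_poly_roots => //; last by rewrite map_inj_uniq //; apply: fmorph_inj.
  by apply/allP => _ /mapP[x _ ->]; rewrite rootE p0.
by rewrite size_map ss ltnn.
Qed.

Lemma mpoly_eq0_closed (m : nat) (f : {mpoly K[m]}) :
  (forall v : 'I_m -> K, f.@[v] = 0) -> f = 0.
Proof.
move=> f0.
(* In [H j] the first [j] arguments of [f] are variables and the others arbitrary constants; each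
   induction step turns one constant into a variable by [poly_eq0_closed]. *)
pose g (w : 'I_m -> K) j : 'I_m -> {mpoly K[m]} :=
  fun i => if (i < j)%N then 'X_i else (w i)%:MP.
have H j w : (j <= m)%N -> mmap (@mpolyC m K) (g w j) f = 0.
  elim: j w => [|j IH] w jm.
    transitivity ((f.@[w])%:MP : {mpoly K[m]}); last by rewrite f0.
    by rewrite /meval rmorph_mmap; apply: eq_mmap.
  pose h : 'I_m -> {poly {mpoly K[m]}} :=
    fun i => if i == j :> nat then 'X else (g w j i)%:P.
  have hE (y : {mpoly K[m]}) : (mmap (polyC \o (@mpolyC m K)) h f).[y] =
      mmap (@mpolyC m K) (fun i => if i == j :> nat then y else g w j i) f.
    rewrite -[LHS]/(horner_eval y _) rmorph_mmap; apply: eq_mmap => [x|i] /=.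
      by rewrite /horner_eval hornerC.
    by rewrite /horner_eval /h; case: ifP => _; rewrite ?hornerX ?hornerC.
  have p0 : mmap (polyC \o (@mpolyC m K)) h f = 0.
    apply: (@poly_eq0_closed _ (@mpolyC m K)) => x; rewrite hE.
    rewrite -[RHS](IH (fun i => if i == j :> nat then x else w i) (ltnW jm)).
    apply: eq_mmap => // i; rewrite /g; case: eqP => // ->.
    by rewrite ltnn.
  have := hE ('X_(Ordinal jm)); rewrite p0 horner0 => ->; apply: eq_mmap => // i.
  rewrite /g ltnS leq_eqVlt; case: eqP => //= e; congr 'X_[_].
  by congr (U_(_))%MM; apply: val_inj.
have := H m (fun=> 0) (leqnn m) => <-.
rewrite -[LHS]comp_mpoly_id; apply: eq_mmap => // i.
by rewrite /g ltn_ord tnth_mktuple.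
Qed.

End ClosedField.

(** * Pluecker coordinates under row operations *)

Lemma map_plucker (R S : comNzRingType) (psi : {rmorphism R -> S}) (k N : nat)
    (A : 'M[R]_(k, N)) : psi \o plucker A =1 plucker (map_mx psi A).
Proof. by move=> i; rewrite /= /plucker -map_mxsub det_map_mx. Qed.

Lemma plucker_mulmx (R : comNzRingType) (k N : nat) (C : 'M[R]_k) (A : 'M[R]_(k, N)) :
  plucker (C *m A) =1 fun i => \det C * plucker A i.
Proof.
move=> i; rewrite /plucker -det_mulmx; congr (\det _); apply/matrixP => x y.
by rewrite !mxE; apply: eq_bigr => z _; rewrite !mxE.
Qed.

Lemma plucker_transvection (R : comNzRingType) (k N : nat) (A B : 'M[R]_(k, N))
    (i j : 'I_k) (c : R) :
  j != i -> row i B = row i A + c *: row j A ->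
  (forall r, r != i -> row r B = row r A) -> plucker B =1 plucker A.
Proof.
move=> ji Bi Br x; rewrite /plucker; set g := tnth _.
pose C : 'M_(k, N) := \matrix_(r, m) if r == i then A j m else A r m.
rewrite (@determinant_multilinear _ _ (colsub g B) (colsub g A) (colsub g C) i 1 c).
- rewrite [\det (colsub g C)](@determinant_alternate _ _ _ j i ji) ?mulr0 ?addr0 ?mul1r //.
  by move=> v; rewrite !mxE eqxx (negbTE ji).
- apply/rowP => v; have /rowP/(_ (g v)) := Bi.
  by rewrite !mxE eqxx mul1r.
- apply/matrixP => u v; rewrite !mxE.
  by have /rowP/(_ (g v)) := Br (lift i u) (negbT (lift_eqF i u)); rewrite !mxE.
apply/matrixP => u v; rewrite !mxE (negbTE (negbT (lift_eqF i u))).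
by have /rowP/(_ (g v)) := Br (lift i u) (negbT (lift_eqF i u)); rewrite !mxE.
Qed.

Definition set_row (R : Type) (k N : nat) (A : 'M[R]_(k, N)) (i : 'I_k) (y : 'rV[R]_N) :=
  \matrix_(r, m) if r == i then y 0 m else A r m.

Lemma row_set_row (R : Type) (k N : nat) (A : 'M[R]_(k, N)) i y r :
  row r (set_row A i y) = if r == i then y else row r A.
Proof. by apply/rowP => m; rewrite !mxE; case: ifP => _; rewrite ?mxE. Qed.

Lemma map_set_row (R S : Type) (psi : R -> S) (k N : nat) (A : 'M[R]_(k, N)) i y :
  map_mx psi (set_row A i y) = set_row (map_mx psi A) i (map_mx psi y).
Proof. by apply/matrixP => r m; rewrite !mxE; case: ifP. Qed.

(** Since [c 0 i = 0], the product [c *m A] combines only rows that [set_row] leaves in place, so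
    adding it to row [i] is a sequence of transvections. *)
Lemma plucker_set_row_add (R : comNzRingType) (k M N : nat) (P : 'M[R]_(M, N))
    (A : 'M[R]_(k, M)) i y (c : 'rV[R]_k) :
  c 0 i = 0 ->
  plucker (set_row A i (y + c *m A) *m P) =1 plucker (set_row A i y *m P).
Proof.
move=> ci.
have -> : c *m A = \sum_(j | j != i) c 0 j *: row j A.
  apply/rowP => m; rewrite summxE mxE (bigD1 i) //= ci mul0r add0r.
  by apply: eq_bigr => j _; rewrite !mxE.
rewrite -big_filter; have : all (fun j => j != i) [seq j <- index_enum 'I_k | j != i].
  exact: filter_all.
elim: [seq j <- _ | _] => [|j s IH] /=; first by rewrite big_nil addr0.
move=> /andP[ji si] x.
rewrite big_cons addrCA addrC -IH //.
apply: (@plucker_transvection _ _ _ _ _ i j (c 0 j) ji) => [|r ri].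
  by rewrite !row_mul !row_set_row eqxx (negbTE ji) !mulmxDl scalemxAl.
by rewrite !row_mul !row_set_row (negbTE ri).
Qed.

(** * Freeing one row along a polynomial path *)

Lemma poly_factorX (R : nzRingType) (p : {poly R}) :
  p != 0 -> exists m (q : {poly R}), q.[0] != 0 /\ p = q * 'X^m.
Proof.
move=> p0; have ex : exists m, p`_m != 0.
  by exists (size p).-1; rewrite -lead_coefE lead_coef_eq0.
case: (ex_minnP ex) => m pm mmin; exists m, (drop_poly m p).
split; first by rewrite horner_coef0 coef_drop_poly add0n.
rewrite -{1}(poly_take_drop m p) [take_poly _ _](_ : _ = 0) ?add0r //.
apply/polyP => j; rewrite coef_take_poly coef0; case: ltnP => // jm.
by apply: contraTeq jm => /mmin; rewrite -leqNgt.
Qed.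

(** Paths are polynomial so that a form along a path is a polynomial in the parameter and has a
    lowest nonzero coefficient. *)
Definition poly_connected (K : nzRingType) (M : nat) (S : 'rV[K]_M -> Prop) :=
  forall x y, S x -> S y -> exists p : 'rV[{poly K}]_M,
    [/\ map_mx (horner_eval 0) p = x, map_mx (horner_eval 1) p = y &
        forall t, S (map_mx (horner_eval t) p)].

Section Exchange.
Variables (K : closedFieldType) (d M N : nat) (P : 'M[K]_(M, N)).
Variable f : plucker_poly K d N.

(** [P] carries row vectors to the coordinates in which minors are taken; the coefficient map [phi]
    allows rows with polynomial entries. *)
Definition plucker_value (R : comNzRingType) (phi : K -> R) (A : 'M[R]_(d, M)) : R :=
  mmap phi (plucker (A *m map_mx phi P)) f.

Lemma plucker_value_morph (R S : comNzRingType) (phi : {rmorphism K -> R})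
    (psi : {rmorphism R -> S}) (phi' : K -> S) A :
  psi \o phi =1 phi' ->
  psi (plucker_value phi A) = plucker_value phi' (map_mx psi A).
Proof.
move=> e; rewrite /plucker_value rmorph_mmap; apply: eq_mmap => // i.
rewrite map_plucker map_mxM -map_mx_comp.
by congr (plucker (_ *m _) _); apply/matrixP => u v; rewrite !mxE -e.
Qed.

Variables (S : 'I_d -> 'rV[K]_M -> Prop) (i : 'I_d) (x0 : 'M[K]_(d, M)) (m0 : 'I_M).
Hypothesis S_conn : forall j, poly_connected (S j).
Hypothesis Sx0 : forall j, S j (row j x0).
(** Density of [S i] modulo the span of the other rows of [x0], as a decomposition off the
    hyperplane where coordinate [m0] vanishes. *)
Hypothesis dense_i : forall z : 'rV[K]_M, z 0 m0 != 0 ->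
  exists (r : 'rV_M) (c : 'rV_d), [/\ S i r, c 0 i = 0 & z = r + c *m x0].
Hypothesis vanish : forall A : 'M[K]_(d, M),
  (forall j, S j (row j A)) -> plucker_value idfun A = 0.

Section Path.
Variable B : 'M[{poly K}]_(d, M).
Hypothesis B0 : forall j, j != i -> map_mx (horner_eval 0) (row j B) = row j x0.
Hypothesis BS : forall t j, j != i -> S j (map_mx (horner_eval t) (row j B)).

Local Notation R := {mpoly K[M]}.
(** [Q] is the form along the path with a generic vector in row [i]: a polynomial in t whose
    coefficients are polynomials in the entries of that vector. *)
Let phi : {rmorphism K -> {poly R}} := polyC \o (@mpolyC M K).
Let gen : 'M[{poly R}]_(d, M) :=
  set_row (map_mx (map_poly (@mpolyC M K)) B) i (\row_m ('X_m)%:P).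
Let Q : {poly R} := plucker_value phi gen.
(** [ev y] puts the moving vector [y] in place of the generic row; evaluation at ['X] merges the
    parameter of [y] with that of the path [B]. *)
Let ev (y : 'rV[{poly K}]_M) : {rmorphism {poly R} -> {poly K}} :=
  horner_eval 'X \o map_poly (mmap polyC (y 0)).

Let evQ y : ev y Q = plucker_value polyC (set_row B i y).
Proof.
rewrite /Q (@plucker_value_morph _ _ phi (ev y) polyC); last first.
  by move=> x; rewrite /= /horner_eval map_polyC hornerC /= mmapC.
congr plucker_value; rewrite /gen map_set_row; congr set_row.
  apply/matrixP => u v; rewrite !mxE /= /horner_eval -map_poly_comp.
  rewrite (eq_map_poly (g := polyC)); last by move=> x; rewrite /= mmapC.
  by rewrite -/(comp_poly 'X (B u v)) comp_polyXr.
apply/rowP => m; rewrite !mxE /= /horner_eval map_polyC hornerC /=.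
by rewrite mmapX mmap1U.
Qed.

Let ev_at0 y q : (ev y q).[0] = q.[0].@[fun m => (y 0 m).[0]].
Proof.
have e (p : {poly {poly K}}) : (p.['X]).[0] = (map_poly (horner_eval 0) p).[0].
  have X0 : horner_eval 0 'X = 0 :> K by rewrite /horner_eval hornerX.
  by have := horner_map (horner_eval (0 : K)) p 'X; rewrite /= X0 => ->.
rewrite /= /horner_eval e -map_poly_comp.
rewrite -[RHS]horner_map rmorph0; congr (_.[_]); apply: eq_map_poly => g.
rewrite /= -[LHS]/(horner_eval 0 _) rmorph_mmap; apply: eq_mmap => x //=.
by rewrite /horner_eval hornerC.
Qed.

Lemma exchange_path y : plucker_value polyC (set_row B i y) = 0.
Proof.
suff Q0 : Q = 0 by rewrite -evQ Q0 rmorph0.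
apply/eqP/negPn/negP => /poly_factorX[m [q [q0 Qq]]].
have evX z : ev z 'X^m != 0.
  by rewrite /= map_polyXn /horner_eval hornerXn monic_neq0 ?monicXn.
(* At each t all rows lie in their sets [S j], so the form vanishes along the path; the factor
   ['X^m] then cancels. *)
have ev_zero r : S i r -> ev (map_mx polyC r) q = 0.
  move=> Sr; apply: (mulIf (evX (map_mx polyC r))); rewrite -rmorphM -Qq evQ mul0r.
  apply: (@poly_eq0_closed _ _ idfun) => t.
  rewrite -[LHS]/(horner_eval t _).
  rewrite (@plucker_value_morph _ _ polyC (horner_eval t) idfun); last first.
    by move=> x; rewrite /= /horner_eval hornerC.
  apply: vanish => j; rewrite map_set_row row_set_row; case: eqVneq => [->|ji].
    rewrite (_ : map_mx _ _ = r) //; apply/rowP => u.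
    by rewrite !mxE /= horner_evalE hornerC.
  by rewrite -map_row; apply: BS.
(* Invariance under translation by the other rows of [B] passes from [Q] to [q] by the same
   cancellation. *)
have ev_add z (c : 'rV_d) : c 0 i = 0 -> ev (z + c *m B) q = ev z q.
  move=> ci; have : ev (z + c *m B) Q = ev z Q.
    by rewrite !evQ; apply: eq_mmap => // u; apply: plucker_set_row_add.
  rewrite Qq !rmorphM /= !map_polyXn; apply: mulIf.
  by rewrite /horner_eval hornerXn monic_neq0 ?monicXn.
have X0 : 'X_m0 != 0 :> R.
  apply: contraTneq (oner_neq0 K) => X0.
  by rewrite -(mevalXU (fun=> 1) m0) X0 meval0 eqxx.
(* The factor ['X_m0] absorbs the hyperplane excluded in [dense_i], so that the product vanishes at
   every vector. *)
suff : q.[0] * 'X_m0 == 0 by rewrite mulf_eq0 (negbTE q0) (negbTE X0).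
apply/eqP/mpoly_eq0_closed => v; rewrite mevalM mevalXU.
have [->|vm] := eqVneq (v m0) 0; first by rewrite mulr0.
have [|r [c [Sr ci vE]]] := dense_i (z := \row_m v m); first by rewrite mxE.
(* [w] extends the decomposition of [v] along the path: at t = 0 it equals [v], because [B] starts
   at [x0] off row [i]. *)
pose w := map_mx polyC r + map_mx polyC c *m B.
suff -> : q.[0].@[v] = 0 by rewrite mul0r.
transitivity ((ev w q).[0]); last by rewrite ev_add ?ev_zero ?horner0 // mxE ci.
rewrite ev_at0; apply: meval_eq => u.
have /rowP/(_ u) := vE; rewrite !mxE => ->; rewrite hornerD hornerC horner_sum.
congr (_ + _); apply: eq_bigr => j _; rewrite !mxE hornerM hornerC.
have [->|ji] := eqVneq j i; first by rewrite ci !mul0r.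
by have /rowP/(_ u) := B0 ji; rewrite !mxE /= horner_evalE => ->.
Qed.

End Path.

Lemma exchange (A : 'M[K]_(d, M)) :
  (forall j, j != i -> S j (row j A)) -> plucker_value idfun A = 0.
Proof.
move=> SA.
have /fin_all_exists[p pP] j : exists p : 'rV[{poly K}]_M, j != i ->
    [/\ map_mx (horner_eval 0) p = row j x0, map_mx (horner_eval 1) p = row j A &
        forall t, S j (map_mx (horner_eval t) p)].
  (* The path 0 in row [i] is a placeholder, overwritten by [set_row]. *)
  case: (eqVneq j i) => [_|ji]; first by exists 0.
  by have [p pP] := S_conn (Sx0 j) (SA j ji); exists p.
pose B : 'M[{poly K}]_(d, M) := \matrix_j p j.
(* Off row [i] the path runs from [x0] at t = 0 to [A] at t = 1, and row [i] is held at that of [A];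
   evaluating at 1 gives the claim. *)
have := @exchange_path B _ _ (map_mx polyC (row i A)).
move=> /(_ _ _)/(congr1 (horner_eval 1)).
rewrite (@plucker_value_morph _ _ polyC (horner_eval 1) idfun); last first.
  by move=> x; rewrite /= /horner_eval hornerC.
rewrite rmorph0 => <-; last 2 first.
- by move=> j ji; rewrite rowK; have [] := pP j ji.
- by move=> t j ji; rewrite rowK; have [_ _] := pP j ji.
congr plucker_value; apply/row_matrixP => j; rewrite map_set_row row_set_row.
case: eqVneq => [->|ji].
  by apply/rowP => u; rewrite !mxE /= horner_evalE hornerC.
by rewrite -map_row rowK; have [_ ->] := pP j ji.
Qed.

End Exchange.

(** * Rank-one matrices: connecting paths and matrix units *)

Definition poly_line (K : nzRingType) (m n : nat) (x y : 'M[K]_(m, n)) :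
    'M[{poly K}]_(m, n) := map_mx polyC x + 'X *: map_mx polyC (y - x).

Lemma poly_lineE (K : comNzRingType) (m n : nat) (x y : 'M[K]_(m, n)) (t : K) :
  map_mx (horner_eval t) (poly_line x y) = x + t *: (y - x).
Proof.
apply/matrixP => i j; rewrite !mxE /= horner_evalE hornerD hornerM hornerX.
by rewrite !hornerC.
Qed.

Lemma poly_line0 (K : comNzRingType) (m n : nat) (x y : 'M[K]_(m, n)) :
  map_mx (horner_eval 0) (poly_line x y) = x.
Proof. by rewrite poly_lineE scale0r addr0. Qed.

Lemma poly_line1 (K : comNzRingType) (m n : nat) (x y : 'M[K]_(m, n)) :
  map_mx (horner_eval 1) (poly_line x y) = y.
Proof. by rewrite poly_lineE scale1r subrKC. Qed.

Lemma poly_connectedT (K : comNzRingType) (M : nat) :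
  poly_connected (fun _ : 'rV[K]_M => True).
Proof.
by move=> x y _ _; exists (poly_line x y); rewrite poly_line0 poly_line1.
Qed.

(** The zero matrix is included, so this is the affine cone over the Segre variety, with matrices
    flattened to row vectors. *)
Definition rank_one (K : comNzRingType) (a b : nat) (z : 'rV[K]_(a * b)) : Prop :=
  exists (u : 'cV_a) (v : 'rV_b), z = mxvec (u *m v).

(** The column factors and the row factors are joined by lines separately, so the product keeps rank
    at most one. *)
Lemma poly_connected_rank_one (K : comNzRingType) (a b : nat) :
  poly_connected (@rank_one K a b).
Proof.
move=> _ _ [u [v ->]] [u' [v' ->]].
exists (mxvec (poly_line u u' *m poly_line v v')).
rewrite !map_mxvec !map_mxM !poly_line0 !poly_line1; split=> // t.
by rewrite map_mxvec map_mxM; do 2!eexists.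
Qed.

(** As [a * b < d], there is room for the corner in slot [i] and for all cells off the first row and
    column. The matrix units at the chosen cells form the base point of the exchange. *)
Lemma hook_indexing (a b d : nat) (i : 'I_d) :
  (a * b < d <= a.+1 * b.+1)%N ->
  exists s : 'I_d -> 'I_a.+1 * 'I_b.+1,
    [/\ injective s, s i = (ord0, ord0) &
        forall p q, p != ord0 -> q != ord0 -> exists j, s j = (p, q)].
Proof.
move=> /andP[abd dab]; have d0 : (0 < d)%N := leq_ltn_trans (leq0n _) abd.
pose T := ('I_a.+1 * 'I_b.+1)%type.
pose in1 := [pred x : T | (x.1 != ord0) && (x.2 != ord0)].
pose z : T := (ord0, ord0).
pose s1 := z :: enum in1; pose s2 := enum [predD1 [predC in1] & z].
have us : uniq (s1 ++ s2).
  rewrite cat_uniq /= mem_enum !enum_uniq inE /= ?eqxx ?andbT /=.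
  apply/hasPn => x; rewrite mem_enum !inE => /andP[xz /negbTE nx].
  by rewrite mem_enum negb_or xz !inE nx.
have mems x : x \in s1 ++ s2.
  by rewrite mem_cat !inE !mem_enum !inE; case: eqVneq => //= _; case: andP.
have sz : size (s1 ++ s2) = (a.+1 * b.+1)%N.
  transitivity #|{: T}|; last by rewrite card_prod !card_ord.
  rewrite cardE; apply: perm_size; apply: uniq_perm => //; first exact: enum_uniq.
  by move=> x; rewrite mems mem_enum.
have sz1 : size s1 = (a * b).+1.
  rewrite /= -cardE; congr _.+1.
  transitivity #|predX (predC1 (ord0 : 'I_a.+1)) (predC1 (ord0 : 'I_b.+1))|.
    by apply: eq_card => x; rewrite !inE.
  by rewrite cardX !cardC1 !card_ord.
pose o := Ordinal d0.
have szd (j : 'I_d) : (j < size (s1 ++ s2))%N by rewrite sz (leq_trans (ltn_ord j)).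
(* The first [d] cells of the list are used; the transposition moves the corner from position 0 to
   slot [i]. *)
exists (fun j => nth z (s1 ++ s2) (tperm o i j)); split.
- move=> j k /eqP; rewrite nth_uniq // => /eqP e.
  by apply: (@perm_inj _ (tperm o i)); apply: val_inj.
- by rewrite tpermR.
move=> p q p0 q0.
have pq : (p, q) \in s1 by rewrite !inE mem_enum !inE p0 q0 orbT.
have lt : (index (p, q) (s1 ++ s2) < d)%N.
  by rewrite index_cat pq (leq_trans _ abd) // -sz1 index_mem.
exists (tperm o i (Ordinal lt)); rewrite tpermK /=.
by rewrite nth_index.
Qed.

(** * Forms vanishing on all tuples of rank-one matrices *)

Section RankOneRowsS.
Variables (K : closedFieldType) (a b d N : nat) (P : 'M[K]_(a.+1 * b.+1, N)).
Variable f : plucker_poly K d N.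
Hypothesis d_bounds : (a * b < d <= a.+1 * b.+1)%N.

Definition unit_rows (s : 'I_d -> 'I_a.+1 * 'I_b.+1) : 'M[K]_(d, a.+1 * b.+1) :=
  \matrix_j mxvec (delta_mx (s j).1 (s j).2).

Lemma rank_one_unit_rows s j : rank_one (row j (unit_rows s)).
Proof.
rewrite rowK; exists (delta_mx (s j).1 0), (delta_mx 0 (s j).2).
by rewrite mul_delta_mx.
Qed.

Lemma vec_mul_unit_rows s (c : 'rV_d) p q :
  vec_mx (c *m unit_rows s) p q = \sum_(j | s j == (p, q)) c 0 j.
Proof.
rewrite mxE mulmx_sum_row summxE [RHS]big_mkcond; apply: eq_bigr => j _.
rewrite mxE rowK mxvecE mxE -xpair_eqE -surjective_pairing eq_sym.
by case: eqP; rewrite ?mulr1 ?mulr0.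
Qed.

Lemma row_free_unit_rows s : injective s -> row_free (unit_rows s).
Proof.
move=> s_inj; rewrite -kermx_eq0; apply/rowV0P => c /sub_kermxP c0.
apply/rowP => j; have := vec_mul_unit_rows s c (s j).1 (s j).2.
rewrite c0 linear0 mxE mxE -surjective_pairing (big_pred1 j) // => k.
by rewrite /= (inj_eq s_inj).
Qed.

(** A Schur complement: [u *m v] has the first row and column of [Z], so [Z - u *m v] is supported
    off them and is a combination of the interior matrix units. *)
Lemma hook_dense s i : injective s -> s i = (ord0, ord0) ->
  (forall p q, p != ord0 -> q != ord0 -> exists j, s j = (p, q)) ->
  forall z : 'rV[K]_(a.+1 * b.+1), z 0 (mxvec_index ord0 ord0) != 0 ->
  exists (r : 'rV_(a.+1 * b.+1)) (c : 'rV_d),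
    [/\ rank_one r, c 0 i = 0 & z = r + c *m unit_rows s].
Proof.
move=> s_inj si s_surj z z0; pose Z : 'M_(a.+1, b.+1) := vec_mx z.
have Z0 : Z ord0 ord0 != 0 by rewrite mxE.
pose u : 'cV_a.+1 := \col_p (Z p ord0 / Z ord0 ord0); pose v := row ord0 Z.
pose W := Z - u *m v.
have WE p q : W p q = Z p q - Z p ord0 / Z ord0 ord0 * Z ord0 q.
  by rewrite !mxE big_ord1 !mxE.
have W0l q : W ord0 q = 0 by rewrite WE divff // mul1r subrr.
have W0r p : W p ord0 = 0 by rewrite WE divfK // subrr.
exists (mxvec (u *m v)), (\row_j W (s j).1 (s j).2); split.
- by exists u, v.
- by rewrite mxE si W0l.
apply: (can_inj (@vec_mxK _ _ _)); rewrite linearD /= mxvecK.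
rewrite -/Z -(subrKC (u *m v) Z) -/W; congr (_ + _).
apply/matrixP => p q; rewrite vec_mul_unit_rows.
rewrite (eq_bigr (fun=> W p q)); last by move=> j /eqP sj; rewrite mxE sj.
case: (eqVneq p ord0) => [->|p0]; first by rewrite W0l big1.
case: (eqVneq q ord0) => [->|q0]; first by rewrite W0r big1.
have [j sj] := s_surj p q p0 q0; rewrite (big_pred1 j) // => k.
by rewrite /= -sj (inj_eq s_inj).
Qed.

Lemma vanish_of_rank_one_rows_succ :
  (forall A : 'M[K]_(d, _), (forall j, rank_one (row j A)) ->
     plucker_value P f idfun A = 0) ->
  forall A, plucker_value P f idfun A = 0.
Proof.
move=> f0.
have H k : (k <= d)%N -> forall A : 'M[K]_(d, _),
    (forall j : 'I_d, (k <= j)%N -> rank_one (row j A)) ->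
    plucker_value P f idfun A = 0.
  elim: k => [_ A SA|k IH kd A SA]; first by apply: f0 => j; apply: SA.
  pose i := Ordinal kd; have [s [s_inj si s_surj]] := hook_indexing i d_bounds.
  (* Rows before [k] are already free and carry no condition; row [k] is the one freed now. *)
  pose S (j : 'I_d) z := (k <= j)%N -> @rank_one K a.+1 b.+1 z.
  apply: (@exchange _ _ _ _ P f S i (unit_rows s) (mxvec_index ord0 ord0)).
  - move=> j; rewrite /S; case: (leqP k j) => kj x y Sx Sy.
      have [p [p0 p1 pS]] := poly_connected_rank_one (Sx isT) (Sy isT).
      by exists p; split.
    have [p [p0 p1 pS]] := @poly_connectedT K _ x y I I.
    by exists p; split.
  - by move=> j _; apply: rank_one_unit_rows.
  - move=> z z0; have [r [c [? ? ?]]] := hook_dense s_inj si s_surj z0.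
    by exists r, c; split.
  - by move=> B SB; apply: IH => //; apply: ltnW.
  move=> j ji kj; apply: SA; rewrite ltn_neqAle kj andbT.
  by apply: contraNneq ji => kj'; apply/eqP/val_inj.
by move=> A; apply: (H d) => // j; rewrite leqNgt ltn_ord.
Qed.

Lemma exists_rank_one_rows_succ :
  exists2 A : 'M[K]_(d, a.+1 * b.+1), forall j, rank_one (row j A) & row_free A.
Proof.
have /andP[d0 _] := d_bounds; pose i := Ordinal (leq_ltn_trans (leq0n _) d0).
have [s [s_inj _ _]] := hook_indexing i d_bounds.
exists (unit_rows s); first exact: rank_one_unit_rows.
exact: row_free_unit_rows.
Qed.

End RankOneRowsS.

Section RankOneRows.
Variables (K : closedFieldType) (a b d : nat).
Hypotheses (a0 : (0 < a)%N) (b0 : (0 < b)%N).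
Hypothesis d_bounds : (a.-1 * b.-1 < d <= a * b)%N.

Lemma vanish_of_rank_one_rows N (P : 'M[K]_(a * b, N)) (f : plucker_poly K d N) :
  (forall A : 'M[K]_(d, _), (forall j, rank_one (row j A)) ->
     plucker_value P f idfun A = 0) ->
  forall A, plucker_value P f idfun A = 0.
Proof.
case: a b a0 b0 d_bounds P => [|a'] // [|b'] // _ _ db P.
exact: vanish_of_rank_one_rows_succ.
Qed.

Lemma exists_rank_one_rows :
  exists2 A : 'M[K]_(d, a * b), forall j, rank_one (row j A) & row_free A.
Proof.
case: a b a0 b0 d_bounds => [|a'] // [|b'] // _ _ db.
exact: exists_rank_one_rows_succ.
Qed.

End RankOneRows.

(** * Forms on the Grassmannian and secant spaces of the Segre cone *)

Lemma plucker_not_row_free (K : fieldType) (k N : nat) (A : 'M[K]_(k, N)) :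
  ~~ row_free A -> plucker A =1 fun=> 0.
Proof.
rewrite -kermx_eq0 => /rowV0Pn[v /sub_kermxP vA v0] i.
rewrite /plucker; set g := tnth _; apply/eqP/det0P; exists v => //.
apply/rowP => j; transitivity ((v *m A) 0 (g j)); last by rewrite vA !mxE.
by rewrite !mxE; apply: eq_bigr => x _; rewrite !mxE.
Qed.

Lemma meval_homog (K : comNzRingType) (m e : nat) (f : {mpoly K[m]}) u (v : 'I_m -> K) :
  f \is e.-homog -> f.@[fun i => u * v i] = u ^+ e * f.@[v].
Proof.
move=> /dhomogP fe; rewrite !mevalE mulr_sumr big_seq [RHS]big_seq.
apply: eq_bigr => x /fe xe; rewrite mulrCA; congr (_ * _).
rewrite -xe /= mdegE -prodrXr -big_split /=.
by apply: eq_bigr => i _; rewrite exprMn.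
Qed.

Section CoordMx.
Variables (K : fieldType) (V : vectType K) (k : nat).
Implicit Types (X : k.+1.-tuple V) (U : {vspace V}).

Lemma mul_coord_mx X (c : 'rV_k.+1) :
  c *m coord_mx X = rVof (vbasis fullv) (\sum_i c 0 i *: tnth X i).
Proof.
apply/rowP => j; rewrite !mxE linear_sum; apply: eq_bigr => i _.
by rewrite linearZ mxE.
Qed.

Lemma row_free_coord_mx X : row_free (coord_mx X) = free X.
Proof.
have E (c : 'rV_k.+1) : (c *m coord_mx X == 0) = (\sum_i c 0 i *: X`_i == 0).
  rewrite mul_coord_mx rVof_eq0 ?vbasisP //.
  by congr (_ == _); apply: eq_bigr => i _; rewrite -tnth_nth.
apply/idP/freeP => [rf c /eqP c0 i|fX].
  have c'0 : (\row_i c i) *m coord_mx X == 0.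
    by rewrite E; apply/eqP; rewrite -[RHS](eqP c0); apply: eq_bigr => j _; rewrite mxE.
  have /rowP/(_ i) := row_free_inj rf (etrans (eqP c'0) (esym (mul0mx _ _))).
  by rewrite !mxE.
rewrite -kermx_eq0; apply/rowV0P => c /sub_kermxP/eqP; rewrite E => /eqP c0.
by apply/rowP => i; rewrite mxE; apply: (fX (c 0)).
Qed.

(** Another basis of [U] differs by a square matrix, which scales the Pluecker vector by its
    determinant. *)
Lemma vanishes_at_basis (f : plucker_poly K k.+1 (\dim {:V})) U X :
  homogeneous f -> basis_of U X -> f.@[plucker (coord_mx X)] = 0 ->
  vanishes_at f U.
Proof.
move=> [e fe] XU f0 Y YU.
pose C := \matrix_(i, j) coord X j (tnth Y i).
have -> : coord_mx Y = C *m coord_mx X.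
  apply/row_matrixP => i; rewrite row_mul mul_coord_mx.
  have YiU : tnth Y i \in U by apply: (basis_mem YU); apply: mem_tnth.
  apply/rowP => j; rewrite !mxE {1}(coord_basis XU YiU); congr coord.
  by apply: eq_bigr => l _; rewrite !mxE -tnth_nth.
by rewrite (meval_eq _ (plucker_mulmx _ _)) (meval_homog _ _ fe) f0 mulr0.
Qed.

End CoordMx.

Lemma Sec_Seg_full (K : closedFieldType) (U W : vectType K)
    (T : {vspace 'Hom(U, W)}) :
  (0 < \dim {:U})%N -> (0 < \dim {:W})%N ->
  ((\dim {:U}).-1 * (\dim {:W}).-1 < \dim T)%N ->
  Sec (\dim T).-1 (@Seg K U W) T.
Proof.
move=> U0 W0 dT; have TS : (\dim T).-1.+1 = \dim T by apply: ltn_predK dT.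
split=> [|C [S [S_hom CP]] spanC]; first by rewrite /Gr TS.
apply/CP; split=> [|f Sf X TX]; first by rewrite /Gr TS.
(* The number [(\dim T).-1] occurs in the types of [f] and [X], hence the generalization to a
   variable [k]. *)
move: (\dim T).-1 TS S S_hom CP spanC f Sf X TX => k TS S S_hom CP spanC f Sf X TX.
pose eU := vbasis {:U}; pose eW := vbasis {:W}; pose eH := vbasis {:'Hom(U, W)}.
pose h := hommx eU eW.
(* [P] is the change from flattened matrices to the coordinates of [Hom(U, W)] used by
   [coord_mx]. *)
pose P := lin1_mx (rVof eH \o h \o vec_mx).
have PE z : z *m P = rVof eH (h (vec_mx z)) by rewrite mul_rV_lin1.
have PX (Y : k.+1.-tuple 'Hom(U, W)) A :
    (forall j, tnth Y j = h (vec_mx (row j A))) -> coord_mx Y = A *m P.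
  move=> YA; apply/row_matrixP => i; rewrite row_mul PE -YA.
  by apply/rowP => j; rewrite !mxE.
have freeP : row_free P.
  rewrite -kermx_eq0; apply/rowV0P => z /sub_kermxP; rewrite PE => /eqP.
  rewrite rVof_eq0 ?vbasisP // hommx_eq0 ?vbasisP // => /eqP z0.
  by rewrite -[z]vec_mxK z0 linear0.
have rank_one_h (u : 'cV_(\dim {:U})) (v : 'rV_(\dim {:W})) : @Seg K U W (h (u *m v)).
  have sub : (limg (h (u *m v)) <= <[vecof eW v]>)%VS.
    apply/subvP => _ /memv_imgP[x _ ->]; rewrite hommxE ?vbasisP // mulmxA.
    by rewrite (mx11_scalar (_ *m u)) mul_scalar_mx linearZ memvZ ?memv_line.
  by rewrite /Seg (leq_trans (dimvS sub)) // dim_vline leq_b1.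
(* Free rows span a genuine member of the Grassmannian, spanned by elements of the Segre cone and
   hence in [C]. *)
have vanish_span (A : 'M_(k.+1, _)) : (forall j, rank_one (row j A)) ->
    row_free (A *m P) -> f.@[plucker (A *m P)] = 0.
  move=> A1 rf; pose Y := [tuple h (vec_mx (row j A)) | j < k.+1].
  have YE : coord_mx Y = A *m P by apply: PX => j; rewrite tnth_mktuple.
  have fY : free Y by rewrite -row_free_coord_mx YE.
  have bY : basis_of <<Y>> Y by rewrite basisEfree fY subvv (eqnP fY) leqnn.
  have /spanC/CP[_ /(_ f Sf)/(_ Y bY)] :
      Gr k <<Y>> /\ spanned_by_section (@Seg K U W) <<Y>>.
    split; first by rewrite /Gr (eqnP fY) size_tuple.
    exists Y; split=> // y /tnthP[j ->]; split; first by rewrite memv_span ?mem_tnth.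
    rewrite tnth_mktuple; have [u [v ->]] := A1 j; rewrite mxvecK.
    exact: rank_one_h.
  by rewrite YE.
suff H : forall A : 'M_(k.+1, _), plucker_value P f idfun A = 0.
  rewrite (PX X (\matrix_j mxvec (mxof eU eW (tnth X j)))) => [|j].
    by have := H (\matrix_j mxvec (mxof eU eW (tnth X j))); rewrite /plucker_value map_mx_id.
  by rewrite rowK mxvecK /h mxofK ?vbasisP.
have dTH : (k.+1 <= \dim {:U} * \dim {:W})%N.
  by rewrite TS (leq_trans (dimvS (subvf T))) // !dimvf.
have bounds : ((\dim {:U}).-1 * (\dim {:W}).-1 < k.+1 <= \dim {:U} * \dim {:W})%N.
  by rewrite dTH andbT TS.
have [A0 A01 A0f] := exists_rank_one_rows K U0 W0 bounds.
have f0 : f.@[plucker (A0 *m P)] = 0.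
  by apply: vanish_span; rewrite // /row_free mxrankMfree.
apply: (vanish_of_rank_one_rows U0 W0 bounds) => A A1.
rewrite /plucker_value map_mx_id // -/(f.@[plucker (A *m P)]).
case: (boolP (row_free (A *m P))) => [/vanish_span-> //|/plucker_not_row_free A0'].
(* Dependent rows have Pluecker vector 0, where f vanishes by homogeneity unless
   it is constant; A0 handles the constants. *)
have [e fe] := S_hom f Sf.
rewrite (meval_eq (v2 := fun i => 0 * plucker (A0 *m P) i)).
  by rewrite (meval_homog _ _ fe) f0 mulr0.
by move=> i; rewrite A0' mul0r.
Qed.

(** * A chain of cells bounding the dimension of the Grassmannian from below *)

Section Schubert.
Variables (K : closedFieldType) (V : vectType K) (k : nat).
Local Notation N := (\dim {:V}).
Implicit Types (A B : 'M[K]_(k.+1, N)) (Z : {vspace V} -> Prop).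

Lemma zclosed_vanishing (f : plucker_poly K k.+1 N) :
  homogeneous f -> zclosed k (fun U => Gr k U /\ vanishes_at f U).
Proof.
move=> fh; exists (eq f); split=> [_ <- //|U].
split=> -[GU fU]; split=> //; last exact: fU.
by move=> _ <-.
Qed.

Lemma zclosed_zclosure Z : (forall U, Z U -> Gr k U) -> zclosed k (zclosure k Z).
Proof.
move=> ZG; exists (fun f => homogeneous f /\ forall U, Z U -> vanishes_at f U).
split=> [f [] //|U]; split=> [[GU CU]|[GU fU]].
  split=> // f [fh fZ]; have [] // := CU _ (zclosed_vanishing fh).
  by move=> U' ZU'; split; [apply: ZG|apply: fZ].
split=> // C [S [Sh CS]] ZC; apply/CS; split=> // f Sf; apply: fU; split; first exact: Sh.
by move=> U' /ZC/CS[_]; apply.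
Qed.

Definition row_tuple A : k.+1.-tuple V :=
  [tuple vecof (vbasis fullv) (row i A) | i < k.+1].

Lemma coord_row_tuple A : coord_mx (row_tuple A) = A.
Proof.
apply/matrixP => i j; rewrite mxE tnth_mktuple coord_vecof ?vbasisP //.
by rewrite mxE.
Qed.

Lemma basis_row_tuple A : row_free A -> basis_of <<row_tuple A>> (row_tuple A).
Proof.
rewrite -{1}(coord_row_tuple A) row_free_coord_mx => fA.
by rewrite basisEfree fA subvv (eqnP fA) leqnn.
Qed.

Definition row_spans (D : 'M[K]_(k.+1, N) -> Prop) U : Prop :=
  exists2 A, D A & U = <<row_tuple A>>%VS.

Lemma Gr_row_spans (D : 'M[K]_(k.+1, N) -> Prop) U :
  (forall A, D A -> row_free A) -> row_spans D U -> Gr k U.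
Proof.
move=> Df [A /Df/basis_row_tuple/basis_free fA ->].
by rewrite /Gr (eqnP fA) size_tuple.
Qed.

(** If neither closed set contains the closure, there are forms nonzero at some [A1] and [A2] in
    [D]. On the line joining these, which stays in [D], both restrict to nonzero polynomials, so
    some t avoids all their roots. *)
Lemma irreducible_row_spans (D : 'M[K]_(k.+1, N) -> Prop) :
  (exists A, D A) -> (forall A, D A -> row_free A) ->
  (forall A B t, D A -> D B -> D (A + t *: (B - A))) ->
  irreducible_subvariety k (zclosure k (row_spans D)).
Proof.
move=> [A0 DA0] Df Dline; have GD := @Gr_row_spans _ _ Df.
have subcl U : row_spans D U -> zclosure k (row_spans D) U.
  by move=> DU; split=> [|C _]; [apply: GD|apply].
split; first exact: zclosed_zclosure.
  by exists <<row_tuple A0>>%VS; apply: subcl; exists A0.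
have witness C : zclosed k C -> ~ subset_of (zclosure k (row_spans D)) C ->
    exists A f, [/\ D A, f.@[plucker A] != 0 &
      forall U, C U -> vanishes_at f U].
  move=> Ccl nC; apply: NNPP => nw; apply: nC => U [GU]; apply=> //.
  case: Ccl => S [Sh CS] _ [A DA ->]; apply/CS; split=> [|f Sf].
    by apply: GD; exists A.
  apply: (vanishes_at_basis (Sh f Sf) (basis_row_tuple (Df A DA))).
  rewrite coord_row_tuple; apply/eqP/negPn/negP => fA; apply: nw.
  by exists A, f; split=> // U' /CS[_]; apply.
move=> C1 C2 C1cl C2cl C12; apply: NNPP => /not_or_and[/witness w1 /witness w2].
have [A1 [f1 [D1 fA1 fC1]]] := w1 C1cl; have [A2 [f2 [D2 fA2 fC2]]] := w2 C2cl.
pose p f : {poly K} := mmap polyC (plucker (poly_line A1 A2)) f.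
have pE f t : (p f).[t] = f.@[plucker (A1 + t *: (A2 - A1))].
  rewrite -[LHS]/(horner_eval t _) rmorph_mmap; apply: eq_mmap => [x|i].
    by rewrite /= horner_evalE hornerC.
  by rewrite map_plucker poly_lineE.
have p1 : p f1 != 0.
  apply: contraNneq fA1 => p0; have := pE f1 0.
  by rewrite scale0r addr0 p0 horner0 => <-.
have p2 : p f2 != 0.
  apply: contraNneq fA2 => p0; have := pE f2 1.
  by rewrite scale1r subrKC p0 horner0 => <-.
have p12 : p f1 * p f2 != 0 by rewrite mulf_neq0.
have [t] := closed_nonrootP _ p12.
rewrite rootM negb_or !rootE !pE; set A := _ + _ => /andP[f1A f2A].
have DA : D A by apply: Dline.
have bA := basis_row_tuple (Df A DA).
case: (C12 <<row_tuple A>>%VS); first by apply: subcl; exists A.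
  by move/fC1/(_ _ bA); rewrite coord_row_tuple; apply/eqP.
by move/fC2/(_ _ bA); rewrite coord_row_tuple; apply/eqP.
Qed.

Hypothesis kN : (k < N)%N.

(** The positions to the right of the identity block, in the order in which they are freed. *)
Definition cells : seq ('I_k.+1 * 'I_N) := enum [pred x : 'I_k.+1 * 'I_N | (k < x.2)%N].

Lemma size_cells : size cells = (k.+1 * (N - k.+1))%N.
Proof.
rewrite -cardE; transitivity #|predX 'I_k.+1 [predC [pred j : 'I_N | (j < k.+1)%N]]|.
  by apply: eq_card => x; rewrite !inE -leqNgt.
rewrite cardX card_ord; congr (_ * _)%N.
have ck : (#|[pred j : 'I_N | (j < k.+1)%N]| = k.+1).
  rewrite -[RHS]card_ord -(card_codom (f := widen_ord kN)); last first.
    by move=> x y /(congr1 val) /= /val_inj.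
  apply: eq_card => j; rewrite !inE; apply/idP/codomP => [jk|[i ->] /=].
    2: exact: ltn_ord.
  by exists (Ordinal jk); apply: val_inj.
have cC := cardC [pred j : 'I_N | (j < k.+1)%N]; rewrite card_ord ck in cC.
by rewrite -[X in (X - _)%N]cC addKn.
Qed.

(* [1 | B] with B supported on the first t cells. *)
Definition cell_mx (t : nat) A : Prop :=
  exists2 B : 'M_(k.+1, N),
    (forall i j, (t <= index (i, j) cells)%N -> B i j = 0) & A = pid_mx k.+1 + B.

Let w : 'I_k.+1 -> 'I_N := widen_ord kN.

Lemma cell_mx_low t A i r : (t <= size cells)%N -> cell_mx t A -> A r (w i) = (r == i)%:R.
Proof.
move=> ts [B B0 ->]; rewrite mxE B0 ?addr0 ?mxE ?ltn_ord ?andbT //.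
(* A position in the identity block is not in [cells], so its [index] is [size cells], which is at
   least [t]. *)
rewrite (leq_trans ts) // leqNgt index_mem mem_enum inE /= -leqNgt.
by rewrite -ltnS.
Qed.

Lemma row_free_cell_mx t A : (t <= size cells)%N -> cell_mx t A -> row_free A.
Proof.
move=> ts At; rewrite -kermx_eq0; apply/rowV0P => c /sub_kermxP/rowP cA.
apply/rowP => i; have := cA (w i); rewrite !mxE (bigD1 i) //=.
rewrite (cell_mx_low _ _ ts At) eqxx mulr1 big1 ?addr0 // => r ri.
by rewrite (cell_mx_low _ _ ts At) (negbTE ri) mulr0.
Qed.

Lemma irreducible_cell_mx t : (t <= size cells)%N ->
  irreducible_subvariety k (zclosure k (row_spans (cell_mx t))).
Proof.
move=> ts; apply: irreducible_row_spans.
- by exists (pid_mx k.+1), 0; rewrite ?addr0 // => i j _; rewrite mxE.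
- by move=> A; apply: row_free_cell_mx.
move=> _ _ c [A A0 ->] [B B0 ->]; exists (A + c *: (B - A)).
  by move=> i j ij; rewrite !mxE A0 // B0 // subrr mulr0 addr0.
by rewrite opprD addrACA subrr add0r addrA.
Qed.

Lemma sorted_enum_set (m : nat) (J : {set 'I_m}) : sorted ltn (map val (enum J)).
Proof.
rewrite sorted_map {1}/enum_mem; apply: sorted_filter => [x y z|]; first exact: ltn_trans.
by rewrite -enumT -(sorted_map (f := val)) val_enum_ord iota_ltn_sorted.
Qed.

Lemma cell_minor p (j : 'I_N) : (k < j)%N -> exists x : 'I_#|{: plucker_index k.+1 N}|,
  (forall A, A p j = 0 -> (forall i r, A r (w i) = (r == i)%:R) -> plucker A x = 0) /\
  (forall A, A p j != 0 -> (forall r, r != p -> A r j = 0) ->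
     (forall i r, A r (w i) = (r == i)%:R) -> plucker A x != 0).
Proof.
move=> kj; have w_inj : injective w by move=> x y /(congr1 val) /= /val_inj.
pose J := j |: [set w i | i in [set~ p]].
have cJ : size (enum J) == k.+1.
  rewrite -cardE cardsU1 card_imset // cardsC1 card_ord /= [j \in _](_ : _ = false) //.
  by apply/imsetP => -[i _ jw]; move: kj; rewrite jw /= ltnNge -ltnS ltn_ord.
have tJ : sorted ltn (map val (Tuple cJ)) := sorted_enum_set J.
exists (enum_rank (exist _ (Tuple cJ) tJ)).
rewrite /plucker enum_rankK /=; set g := tnth _.
have gJ s : g s = j \/ exists2 i, i != p & g s = w i.
  have : g s \in Tuple cJ by apply: mem_tnth.
  rewrite mem_enum !inE => /orP[/eqP->|/imsetP[i]]; first by left.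
  by rewrite !inE => ip ->; right; exists i.
have Jg j' : j' \in J -> exists s, g s = j'.
  by rewrite -mem_enum => /(tnthP (Tuple cJ))[s ->]; exists s.
split=> A Apj => [Aw|Aj Aw].
  apply/eqP/det0P; exists (delta_mx 0 p).
    by apply/eqP => /rowP/(_ p)/eqP; rewrite !mxE !eqxx oner_eq0.
  rewrite -rowE; apply/rowP => s; rewrite !mxE.
  by case: (gJ s) => [->|[i ip ->]]; rewrite ?Apj // Aw eq_sym (negbTE ip).
apply/det0P => -[v v0 /rowP vA].
have vr r : r != p -> v 0 r = 0.
  move=> rp; have [|s gs] := Jg (w r).
    by rewrite !inE imset_f ?orbT // !inE.
  have := vA s; rewrite !mxE (bigD1 r) //= mxE gs Aw eqxx mulr1 big1 ?addr0 //.
  by move=> r' r'r; rewrite mxE gs Aw (negbTE r'r) mulr0.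
have [|s gs] := Jg j; first by rewrite !inE eqxx.
have := vA s; rewrite !mxE (bigD1 p) //= mxE gs big1 ?addr0; last first.
  by move=> r rp; rewrite vr // mul0r.
move/eqP; rewrite mulf_eq0 (negbTE Apj) orbF => /eqP vp.
case/eqP: v0; apply/rowP => r; rewrite mxE.
by have [->|/vr] := eqVneq r p.
Qed.

(** Strictness at stage [t]: the minor of cell number [t], counted from 0, vanishes on the closure
    of that stage but not at [A1], which belongs to the next stage. *)
Lemma cell_mx_chain :
  has_chain k (Gr k : {vspace V} -> Prop) (k.+1 * (N - k.+1)).
Proof.
exists (fun t => zclosure k (row_spans (cell_mx t))); rewrite -size_cells.
split=> [t|t ts|U []] //; first exact: irreducible_cell_mx.
have GZ u : (u <= size cells)%N -> forall U, row_spans (cell_mx u) U -> Gr k U.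
  by move=> us U; apply: Gr_row_spans => A; apply: row_free_cell_mx.
have sub U : row_spans (cell_mx t) U -> row_spans (cell_mx t.+1) U.
  case=> _ [B B0 ->] ->; eexists; last by [].
  by exists B => // i j ij; apply: B0; apply: ltnW.
split=> [U [GU CU]|]; first by split=> // C Ccl DC; apply: CU => // U' /sub; apply: DC.
case ez : (nth (ord0, w ord0) cells t) => [p j].
have jc : (p, j) \in cells by rewrite -ez mem_nth.
have kj : (k < j)%N by move: jc; rewrite mem_enum.
have zt : index (p, j) cells = t by rewrite -ez index_uniq // enum_uniq.
have [x [x0 x1]] := cell_minor p kj.
have Xh : homogeneous ('X_x : plucker_poly K k.+1 N).
  by exists 1%N; rewrite dhomogX /= mdeg1.
pose A1 : 'M[K]_(k.+1, N) := pid_mx k.+1 + delta_mx p j.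
have A1t : cell_mx t.+1 A1.
  exists (delta_mx p j) => // r s rs; rewrite mxE.
  by case: eqP => //= er; case: eqP => //= es; move: rs; rewrite er es zt ltnn.
have pid0 (r : 'I_k.+1) : pid_mx k.+1 r j = 0 :> K.
  by rewrite mxE ltn_eqF //; apply: leq_trans (ltn_ord r) _.
move=> /(_ <<row_tuple A1>>%VS); case.
  split=> [|C _]; last by apply; exists A1.
  by apply: (GZ t.+1 ts); exists A1.
move=> _ /(_ _ (zclosed_vanishing Xh))[].
  move=> U [A At ->]; split.
    by apply: (GZ t (ltnW ts)); exists A.
  apply: (vanishes_at_basis Xh (basis_row_tuple (row_free_cell_mx (ltnW ts) At))).
  rewrite coord_row_tuple mevalXU x0 //.
    2: by move=> i r; apply: cell_mx_low At; apply: ltnW.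
  by case: At => B B0 ->; rewrite mxE pid0 B0 ?zt // addr0.
move=> _ /(_ _ (basis_row_tuple (row_free_cell_mx ts A1t))).
rewrite coord_row_tuple mevalXU; apply/eqP/x1.
- by rewrite mxE pid0 add0r mxE !eqxx oner_eq0.
- by move=> r rp; rewrite mxE pid0 add0r mxE (negbTE rp).
by move=> i r; apply: cell_mx_low A1t.
Qed.

End Schubert.

(** * Isotropy from the dimension count *)

Theorem proposition13 (K : closedFieldType) (charK : [pchar K] =i pred0)
    (n l : nat) (hl : (l < n)%N)
    (Sigma : {vspace 'rV[K]_n.+1} -> Prop)
    (hSigma : irreducible_subvariety l Sigma)
    (c : nat) (hc : has_codim l Sigma c) (hcn : (c <= n - 1)%N) :
  isotropic l Sigma.
Proof.
split=> //; case: hc => d [e [Sd [_ Ge] ede]].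
have dimV : \dim {:'rV[K]_n.+1} = n.+1 by rewrite dimvf /dim /= mul1n.
have e_ge : (l.+1 * (n - l) <= e)%N.
  rewrite -(subSS l n) -dimV; apply: Ge; apply: cell_mx_chain.
  by rewrite dimV ltnS ltnW.
have [m nE] : exists m, n = (l + m.+1)%N by exists (n - l.+1)%N; lia.
(* Here [c <= n - 1 = l + m] and [e >= (l + 1) * (m + 1)], so [d = e - c] is at least
   [l * m + 1]. *)
have d_gt : (l * m < d)%N by nia.
exists d; split=> // [|L [SL [chL maxL]]]; first by lia.
have dT : \dim (tangent_space l Sigma L) = d.
  by apply/eqP; rewrite eqn_leq (maxL _ Sd.1) (Sd.2 _ chL).
have dL : \dim L = l.+1.
  by case: hSigma => -[S [_ SigS]] _ _; case/SigS: SL.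
have dU : \dim {:subvs_of L} = l.+1 by rewrite dimvf.
have dW : \dim {:quotv L} = m.+1.
  by rewrite dimvf -[LHS]/(\dim L^C) dimv_compl dimV dL; lia.
by rewrite -dT; apply: Sec_Seg_full; rewrite ?dU ?dW // dT.
Qed.
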